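(* Let $G$ be a commutative group, let $r$ be a positive integer, and for each $\alpha \in \mathbb{N}^{r}$ let $f_{\alpha}\colon G\to\mathbb{C}$ be a function. If $(f_{\alpha})_{\alpha\in\mathbb{N}^{r}}$ is a generalized moment sequence of rank $r$ whose generating function $f_{0}$ is not identically zero, then there exist an exponential $m\colon G\to\mathbb{C}$ and a family $a=(a_{\alpha})_{\alpha\in\mathbb{N}^{r}}$ of additive functions $a_\alpha\colon G\to\mathbb{C}$ such that for every multi-index $\alpha\in\mathbb{N}^{r}$ and every $x\in G$ $$f_{\alpha}(x)=B_{\alpha}(a(x))\,m(x),$$ where $a(x)=(a_\alpha(x))_{\alpha\in\mathbb{N}^r}$ and $B_\alpha$ denotes the multivariate Bell polynomial.
   Context: $\mathbb{N}$ is the set of nonnegative integers. Groups are written additively and carry the discrete topology (so every function is continuous). An exponential on $G$ is a function $m\colon G\to\mathbb{C}$, not identically zero, with $m(x+y)=m(x)m(y)$ for all $x,y\in G$. An additive function is a homomorphism $G\to(\mathbb{C},+)$. Multi-index notation for $\alpha,\beta\in\mathbb{N}^r$: $\alpha!=\prod_{k=1}^r\alpha_k!$, $|\alpha|=\sum_{k=1}^r\alpha_k$, $t^\alpha=\prod_{k=1}^r t_k^{\alpha_k}$, $\binom{\alpha}{\beta}=\prod_{k=1}^r\binom{\alpha_k}{\beta_k}$; $\beta\le\alpha$ means $\beta_k\le\alpha_k$ for all $k$; $\beta<\alpha$ means $\beta\le\alpha$ and $\beta\ne\alpha$. Generalized moment sequence of rank $r$: a family $(f_\alpha)_{\alpha\in\mathbb{N}^r}$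 of functions $f_\alpha\colon G\to\mathbb{C}$ such that for all $\alpha\in\mathbb{N}^r$ and all $x,y\in G$ $$f_\alpha(x+y)=\sum_{\beta\le\alpha}\binom{\alpha}{\beta}f_\beta(x)f_{\alpha-\beta}(y).$$ The function $f_0$, with $0=(0,\dots,0)\in\mathbb{N}^r$, is called the generating function of the sequence. Multivariate Bell polynomials: for variables $x=(x_\mu)_{\mu\in\mathbb{N}^r}$ and $\alpha\in\mathbb{N}^r$, $$B_\alpha(x)=\alpha!\sum\prod_{0<\mu\le\alpha}\frac{x_\mu^{c_\mu}}{c_\mu!\,(\mu!)^{c_\mu}},$$ where the sum runs over all families $(c_\mu)_{0<\mu\le\alpha}$ of nonnegative integers with $\sum_{0<\mu\le\alpha}c_\mu\,\mu=\alpha$. Equivalently, as formal power series in $t=(t_1,\dots,t_r)$, $\sum_{\alpha\in\mathbb{N}^r}B_\alpha(x)\frac{t^\alpha}{\alpha!}=\exp\Big(\sum_{|\mu|\ge1}x_\mu\frac{t^\mu}{\mu!}\Big)$. In particular $B_0=1$, and $B_\alpha$ does not depend on $x_0$. *)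

(* Defs.v *)
(* MathComp; for R : realType, R[i] is the field of complex numbers. *)
From HB Require Import structures.
From mathcomp Require Import all_boot all_order all_algebra.
From mathcomp Require Import reals complex.
From mathcomp.multinomials Require Import mpoly.

Set Implicit Arguments.
Unset Strict Implicit.
Unset Printing Implicit Defensive.

Import Order.TTheory GRing.Theory Num.Theory.
Local Open Scope ring_scope.

(* On 'X_{1..r}, (b <= a)%MM is the componentwise order, (b < a)%MM means
   b <= a and b != a, and (a - b)%MM is the componentwise difference.  Since
   b <= a forces mdeg b <= mdeg a, a sum or product over all multi-indices
   below a is taken over the finite type 'X_{1..r < (mdeg a).+1}. *)

Definition mnm_fact r (a : 'X_{1..r}) : nat := (\prod_(k < r) (a k)`!)%N.

Definition mnm_bin r (a b : 'X_{1..r}) : nat := (\prod_(k < r) 'C(a k, b k))%N.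

Definition moment_sequence (R : realType) (G : zmodType) r
    (f : 'X_{1..r} -> G -> R[i]) : Prop :=
  forall (a : 'X_{1..r}) (x y : G),
    f a (x + y) =
      \sum_(b : 'X_{1..r < (mdeg a).+1} | (b <= a)%MM)
        (mnm_bin a b)%:R * f b x * f (a - b)%MM y.

Definition exponential (R : realType) (G : zmodType) (m : G -> R[i]) : Prop :=
  (exists x : G, m x != 0) /\ (forall x y : G, m (x + y) = m x * m y).

Section Bell.
Variables (F : numFieldType) (r : nat).

Definition bell_index (a : 'X_{1..r}) : finType :=
  {mu : 'X_{1..r < (mdeg a).+1} | ((0 < mu) && (mu <= a))%MM}.

Definition bell_mnm (a : 'X_{1..r}) (mu : bell_index a) : 'X_{1..r} :=
  bmnm (val mu).

(* A family c of multiplicities with \sum_mu c_mu * mu = a has all its values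
   at most mdeg a, because mdeg mu >= 1.  The sum can therefore range over
   functions into 'I_(mdeg a).+1. *)
Lemma bell_mult_bound (a : 'X_{1..r}) (c : bell_index a -> nat) :
  (\sum_mu bell_mnm mu *+ c mu)%MM = a -> forall mu, (c mu < (mdeg a).+1)%N.
Proof.
move=> {2}<- mu; rewrite ltnS mdeg_sum (bigD1 mu) //=.
apply: leq_trans (leq_addr _ _); rewrite mdegMn leq_pmull // lt0n mdeg_eq0.
by have /andP[/andP[mu0 _] _] := valP mu; rewrite eq_sym.
Qed.

Definition bell (a : 'X_{1..r}) (x : 'X_{1..r} -> F) : F :=
  (mnm_fact a)%:R *
  \sum_(c : {ffun bell_index a -> 'I_(mdeg a).+1}
          | (\sum_mu bell_mnm mu *+ c mu)%MM == a)
    \prod_mu (x (bell_mnm mu) ^+ c mu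
              / ((c mu)`!%:R * (mnm_fact (bell_mnm mu))%:R ^+ c mu)).

End Bell.

(* Main.v *)
(* Write f_a = g_a f_0, where f_0 is an exponential.  Bell polynomials are the
   Taylor coefficients of exp(sum_mu x_mu t^mu / mu!), so exp(u + v) =
   exp(u) exp(v) gives
     B_a(x + y) = sum_(b <= a) bin(a, b) B_b(x) B_(a - b)(y),
   while B_a(x) - x_a only involves the x_mu with 0 < mu < a.  Hence x |-> B(x)
   is a bijection from the families with x_0 = 0 onto those whose value at 0
   is 1, and a(x) can be defined as the preimage of (g_b(x))_b.  Both
   a(x) + a(y) and a(x + y) are preimages of g(x + y), hence a is additive.

   Power series are replaced by polynomials, compared on the coefficients of
   index b <= a only, and the exponential by its truncations. *)
Require Import Defs.
From HB Require Import structures.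
From mathcomp Require Import all_boot all_order all_algebra.
From mathcomp Require Import reals complex.
From mathcomp Require Import ring.
From mathcomp.multinomials Require Import mpoly.

Import Order.TTheory GRing.Theory Num.Theory.
Local Open Scope ring_scope.

Set Implicit Arguments.
Unset Strict Implicit.
Unset Printing Implicit Defensive.

(** * Arithmetic of multi-indices *)

Lemma mnm_fact_gt0 r (a : 'X_{1..r}) : (0 < mnm_fact a)%N.
Proof. by apply: prodn_gt0 => k; rewrite fact_gt0. Qed.

Lemma mnm_bin_fact r (a b : 'X_{1..r}) : (b <= a)%MM ->
  (mnm_bin a b * (mnm_fact b * mnm_fact (a - b)%MM) = mnm_fact a)%N.
Proof.
move=> /mnm_lepP ba; rewrite /mnm_bin /mnm_fact -!big_split /=.
by apply: eq_bigr => k _; rewrite mnmBE bin_fact.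
Qed.

Lemma lepm_mdeg r (a b : 'X_{1..r}) : (b <= a)%MM -> (mdeg b <= mdeg a)%N.
Proof. by move/submK=> <-; rewrite mdegD leq_addl. Qed.

Lemma ltpm_mdeg r (a b : 'X_{1..r}) : (b < a)%MM -> (mdeg b < mdeg a)%N.
Proof.
move=> /andP[nba ba]; rewrite -(submK ba) mdegD -[X in (X < _)%N]add0n ltn_add2r.
rewrite lt0n mdeg_eq0; apply: contraNneq nba => e.
by rewrite -(submK ba) e add0m.
Qed.

Lemma lepm0 r (b : 'X_{1..r}) : (b <= 0)%MM = (b == 0%MM).
Proof.
apply/idP/eqP => [/lepm_mdeg|->]; last exact: lepm_refl.
by rewrite mdeg0 leqn0 mdeg_eq0 => /eqP.
Qed.

Lemma le0pm r (b : 'X_{1..r}) : (0 <= b)%MM.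
Proof. by apply/mnm_lepP => i; rewrite mnm0E. Qed.

Lemma mcoeffM_le (R : nzRingType) r (p q : {mpoly R[r]}) (a : 'X_{1..r}) :
  (p * q)@_a =
    \sum_(b : 'X_{1..r < (mdeg a).+1} | (b <= a)%MM) p@_b * q@_(a - b).
Proof. exact: mcoeff_poly_mul_lin. Qed.

(** * Agreement of polynomials on the indices below [a] *)

Section Upto.
Variables (R : nzRingType) (r : nat).
Implicit Types (a b : 'X_{1..r}) (p q : {mpoly R[r]}).

Definition eq_upto a p q := forall b, (b <= a)%MM -> p@_b = q@_b.

(** The coefficient of index [b] in a product only involves coefficients of indices below [b], and
    the set of indices below [a] is closed downwards. *)
Lemma eq_uptoM a p p' q q' :
  eq_upto a p p' -> eq_upto a q q' -> eq_upto a (p * q) (p' * q').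
Proof.
move=> ep eq b ba; rewrite !mcoeffM_le; apply: eq_bigr => c cb.
rewrite ep ?(lepm_trans cb) // eq //.
exact: lepm_trans (lem_subr _ _) ba.
Qed.

Lemma eq_upto_prod (I : eqType) a (s : seq I) (E E' : I -> {mpoly R[r]}) :
  (forall i, i \in s -> eq_upto a (E i) (E' i)) ->
  eq_upto a (\prod_(i <- s) E i) (\prod_(i <- s) E' i).
Proof.
elim: s => [|i s IH] e; first by rewrite !big_nil.
rewrite !big_cons; apply: eq_uptoM; first by apply: e; rewrite mem_head.
by apply: IH => j js; apply: e; rewrite inE js orbT.
Qed.

End Upto.

(** * Truncated exponentials *)

Section BellTheory.
Variables (F : numFieldType) (r : nat).
Implicit Types (a b mu : 'X_{1..r}) (z w : F) (x y g : 'X_{1..r} -> F).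

Let fact_neq0 k : k`!%:R != 0 :> F.
Proof. by rewrite pnatr_eq0 -lt0n fact_gt0. Qed.

Let mnm_fact_neq0 a : (mnm_fact a)%:R != 0 :> F.
Proof. by rewrite pnatr_eq0 -lt0n mnm_fact_gt0. Qed.

(** Coefficient of t^(k mu) in exp(z t^mu / mu!). *)
Definition exp_coef mu k z : F := z ^+ k / (k`!%:R * (mnm_fact mu)%:R ^+ k).

Definition exp_trunc N mu z : {mpoly F[r]} :=
  \sum_(k < N) exp_coef mu k z *: 'X_[mu *+ k].

Lemma exp_coefD mu s z w :
  exp_coef mu s (z + w) =
    \sum_(i < s.+1) exp_coef mu i z * exp_coef mu (s - i) w.
Proof.
rewrite /exp_coef addrC exprDn mulr_suml; apply: eq_bigr => i _.
have is_ : (i <= s)%N by rewrite -ltnS.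
have -> : (mnm_fact mu)%:R ^+ s =
    (mnm_fact mu)%:R ^+ (s - i) * (mnm_fact mu)%:R ^+ i :> F.
  by rewrite -exprD subnK.
rewrite -mulr_natr -(bin_fact is_) !natrM; field.
by rewrite !expf_neq0 // !fact_neq0 pnatr_eq0 -lt0n bin_gt0 is_.
Qed.

Lemma mcoeff_exp_trunc N mu z b :
  (exp_trunc N mu z)@_b =
    \sum_(k < N) exp_coef mu k z * ((mu *+ k)%MM == b)%:R.
Proof.
by rewrite raddf_sum; apply: eq_bigr => k _; rewrite /= mcoeffZ mcoeffX.
Qed.

Lemma mulmn_eq_ltn N a b mu k : mu != 0%MM -> (mdeg a < N)%N -> (b <= a)%MM ->
  (mu *+ k)%MM == b -> (k < N)%N.
Proof.
move=> mu0 aN /lepm_mdeg ba /eqP e; apply: leq_ltn_trans aN.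
by apply: leq_trans ba; rewrite -e mdegMn leq_pmull // lt0n mdeg_eq0.
Qed.

(** Since [mu] is nonzero, [mu *+ k] has degree at least [k], so the terms with [k >= N] have degree
    above [mdeg a]. *)
Lemma eq_upto_exp_trunc N N' a mu z : mu != 0%MM ->
  (mdeg a < N)%N -> (N <= N')%N ->
  eq_upto a (exp_trunc N' mu z) (exp_trunc N mu z).
Proof.
move=> mu0 aN NN' b ba; rewrite !mcoeff_exp_trunc.
rewrite (big_ord_widen N' (fun k => exp_coef mu k z * (mu *+ k == b)%MM%:R) NN').
rewrite [RHS]big_mkcond; apply: eq_bigr => k _; case: ifP => // kN.
by case: eqP => [/eqP/(mulmn_eq_ltn mu0 aN ba)|]; rewrite ?kN ?mulr0.
Qed.

Lemma exp_coef0 mu z : exp_coef mu 0 z = 1.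
Proof. by rewrite /exp_coef !expr0 mulr1 divr1. Qed.

(** The terms with [k >= 2] have degree above [mdeg mu]. *)
Lemma eq_upto_exp_trunc_top N mu z : mu != 0%MM -> (mdeg mu < N)%N ->
  eq_upto mu (exp_trunc N mu z) (1 + (z / (mnm_fact mu)%:R) *: 'X_[mu]).
Proof.
move=> mu0 muN b bmu; rewrite mcoeff_exp_trunc mcoeffD mcoeff1 mcoeffZ mcoeffX.
case: N muN => // -[|N] muN.
  by move: mu0; rewrite -mdeg_eq0 -leqn0 -ltnS muN.
rewrite !big_ord_recl /= mulm0n exp_coef0 mul1r (eq_sym 0%MM); congr (_ + _).
rewrite big1 ?addr0.
  by rewrite mulm1n /exp_coef !expr1 mul1r.
move=> k _; rewrite /bump /= !add1n; case: eqP => [e|]; rewrite ?mulr0 //.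
have := lepm_mdeg bmu; rewrite -e mdegMn leqNgt ltn_Pmulr //.
by rewrite lt0n mdeg_eq0.
Qed.

(** Every term with [k >= 1] has its exponent above [mu], hence not below [a]. *)
Lemma eq_upto_exp_trunc1 N a mu z : (0 < N)%N -> ~~ (mu <= a)%MM ->
  eq_upto a (exp_trunc N mu z) 1.
Proof.
case: N => // N _ mua b ba; rewrite mcoeff_exp_trunc mcoeff1 big_ord_recl /=.
rewrite mulm0n exp_coef0 mul1r eq_sym big1 ?addr0 // => k _.
case: eqP => [e|]; rewrite ?mulr0 //; case/negP: mua.
by apply: lepm_trans ba; rewrite -e /bump /= add1n mulmS lem_addr.
Qed.

Lemma eq_upto_exp_truncD N a mu z w : mu != 0%MM -> (mdeg a < N)%N ->
  eq_upto a (exp_trunc N mu (z + w)) (exp_trunc N mu z * exp_trunc N mu w).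
Proof.
move=> mu0 aN b ba; rewrite mcoeff_exp_trunc.
pose T i s := exp_coef mu i z * exp_coef mu (s - i) w * ((mu *+ s)%MM == b)%:R.
(* Here [s] is the total power of t^mu: [i] from the factor in [z], [s - i] from the factor in
   [w]. *)
transitivity (\sum_(i < N) \sum_(i <= s < N) T i s).
  under [RHS]eq_bigr => i _ do rewrite big_geq_mkord /=.
  rewrite (exchange_big_dep xpredT) //=; apply: eq_bigr => s _.
  rewrite exp_coefD mulr_suml (big_ord_widen N (fun i => T i s)) //.
rewrite /exp_trunc mulr_suml raddf_sum; apply: eq_bigr => i _ /=.
rewrite mulr_sumr raddf_sum /= -(add0n i) big_addn add0n.
rewrite -(big_mkord xpredT (fun k =>
  ((exp_coef mu i z *: 'X_[mu *+ i]) * (exp_coef mu k w *: 'X_[mu *+ k]))@_b)).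
(* The terms past [N - i] have total power at least [N], so degree above [mdeg a], and vanish at
   [b]. *)
rewrite [RHS](big_cat_nat (n := N - i)) ?leq_subr //=.
have E k : ((exp_coef mu i z *: 'X_[mu *+ i]) * (exp_coef mu k w *: 'X_[mu *+ k]))@_b
   = T i (k + i)%N.
  rewrite -scalerAl -scalerAr scalerA mcoeffZ -mpolyXD mcoeffX /T addnK.
  congr (_ * (_ == _)%:R).
  by apply/mnmP => j; rewrite mnmDE !mulmnE mulnDr addnC.
rewrite [X in _ + X]big1_seq ?addr0; first by apply: eq_bigr => k _; rewrite E.
move=> k /=; rewrite mem_index_iota leq_subLR => /andP[Nk _]; rewrite E /T.
by case: eqP => [/eqP/(mulmn_eq_ltn mu0 aN ba)|]; rewrite ?mulr0 // ltnNge addnC Nk.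
Qed.

(** * Bell polynomials as coefficients of products of exponentials *)

Definition bell_support a : seq 'X_{1..r} :=
  [seq bell_mnm i | i : bell_index a].

Lemma mem_bell_support a mu :
  (mu \in bell_support a) = ((0 < mu)%MM && (mu <= a)%MM).
Proof.
apply/imageP/idP => [[i _ ->]|mua]; first exact: (valP i).
have mu_lt : (mdeg mu < (mdeg a).+1)%N.
  by rewrite ltnS; case/andP: mua => _ /lepm_mdeg.
by exists (Sub (BMultinom mu_lt) mua).
Qed.

Lemma bell_support_uniq a : uniq (bell_support a).
Proof. by rewrite map_inj_uniq ?enum_uniq // => i j /val_inj/val_inj. Qed.

Lemma bell_support_neq0 a mu : mu \in bell_support a -> mu != 0%MM.
Proof. by rewrite mem_bell_support eq_sym => /andP[/andP[]]. Qed.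

Definition exp_prod N (s : seq 'X_{1..r}) x : {mpoly F[r]} :=
  \prod_(mu <- s) exp_trunc N mu (x mu).

(** Expanding the product picks the term of rank [c mu] in each factor; the exponents add up to the
    sum of the [mu *+ c mu], so the coefficient at [a] keeps exactly the families [c] of the
    definition. *)
Lemma bell_mcoeff a x :
  bell a x = (mnm_fact a)%:R * (exp_prod (mdeg a).+1 (bell_support a) x)@_a.
Proof.
rewrite /bell /exp_prod big_image /= bigA_distr_bigA raddf_sum big_mkcond /=.
congr (_ * _); apply: eq_bigr => c _.
rewrite scaler_prod mprodXE.
by rewrite mcoeffZ mcoeffX; case: eqP; rewrite ?mulr1 ?mulr0.
Qed.

(** Lets one product serve all indices below [a], as [bellD] requires: up to [b], the factors with
    [mu] not below [b] are 1 and longer truncations make no difference. *)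
Lemma bell_mcoeff_le N a b x : (b <= a)%MM -> (mdeg a < N)%N ->
  bell b x = (mnm_fact b)%:R * (exp_prod N (bell_support a) x)@_b.
Proof.
move=> ba aN; rewrite bell_mcoeff; congr (_ * _); apply/esym.
pose E mu := if (mu <= b)%MM then exp_trunc (mdeg b).+1 mu (x mu) else 1.
have /(_ b (lepm_refl b)) -> : eq_upto b (exp_prod N (bell_support a) x)
    (\prod_(mu <- bell_support a) E mu).
  apply: eq_upto_prod => mu /bell_support_neq0 mu0; rewrite /E; case: ifP => mub.
    by apply: eq_upto_exp_trunc => //; rewrite (leq_ltn_trans (lepm_mdeg ba)).
  by apply: eq_upto_exp_trunc1; rewrite ?mub // (leq_trans _ aN).
rewrite -big_mkcond -big_filter /exp_prod; congr (_@_b); apply: perm_big.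
apply: uniq_perm; rewrite ?filter_uniq ?bell_support_uniq // => mu.
rewrite mem_filter !mem_bell_support andbCA; case mub : (mu <= b)%MM => //=.
by rewrite (lepm_trans mub ba).
Qed.

Lemma mcoeff0_exp_prod N (s : seq 'X_{1..r}) x : (0 < N)%N ->
  (forall mu, mu \in s -> mu != 0%MM) -> (exp_prod N s x)@_0 = 1.
Proof.
move=> N0 s0; have /(_ _ (lepm_refl _)) -> : eq_upto 0%MM (exp_prod N s x)
    (\prod_(mu <- s) 1).
  apply: eq_upto_prod => mu /s0 mu0; apply: eq_upto_exp_trunc1 => //.
  by rewrite lepm0.
by rewrite big1 // mcoeff1 eqxx.
Qed.

Lemma bell0 x : bell 0%MM x = 1.
Proof.
rewrite bell_mcoeff mcoeff0_exp_prod //; last exact: bell_support_neq0.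
by rewrite mulr1 /mnm_fact big1 // => k _; rewrite mnm0E.
Qed.

Lemma bellD a x y :
  bell a (fun mu => x mu + y mu) =
    \sum_(b : 'X_{1..r < (mdeg a).+1} | (b <= a)%MM)
      (mnm_bin a b)%:R * bell b x * bell (a - b)%MM y.
Proof.
have -> : bell a (fun mu => x mu + y mu) = (mnm_fact a)%:R *
    (exp_prod (mdeg a).+1 (bell_support a) x *
     exp_prod (mdeg a).+1 (bell_support a) y)@_a.
  rewrite bell_mcoeff /exp_prod -big_split /=; congr (_ * _).
  suff /(_ a (lepm_refl a)) : eq_upto a (exp_prod (mdeg a).+1 (bell_support a)
      (fun mu => x mu + y mu)) (\prod_(mu <- bell_support a)
      (exp_trunc (mdeg a).+1 mu (x mu) * exp_trunc (mdeg a).+1 mu (y mu))) by [].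
  apply: eq_upto_prod => mu /bell_support_neq0 mu0.
  exact: eq_upto_exp_truncD.
rewrite mcoeffM_le mulr_sumr; apply: eq_bigr => b ba.
rewrite (bell_mcoeff_le (N := (mdeg a).+1) x ba) //.
rewrite (bell_mcoeff_le (N := (mdeg a).+1) y (lem_subr a b)) //.
rewrite -(mnm_bin_fact ba) !natrM; ring.
Qed.

(** Up to [a], the factor of index [a] is 1 + x_a t^a / a!, and the product of the others has
    constant coefficient 1; so x_a enters only as a summand x_a. *)
Lemma bell_top a x y : a != 0%MM ->
  (forall mu, (0 < mu)%MM -> (mu < a)%MM -> x mu = y mu) ->
  bell a x - x a = bell a y - y a.
Proof.
move=> a0 xy.
have a_in : a \in bell_support a.
  by rewrite mem_bell_support /ltm eq_sym a0 le0pm lepm_refl.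
pose s := rem a (bell_support a).
have bellE (z : _ -> F) : bell a z - z a = (mnm_fact a)%:R * (exp_prod (mdeg a).+1 s z)@_a.
  rewrite bell_mcoeff /exp_prod (perm_big _ (perm_to_rem a_in)) big_cons /= -/s.
  have /(_ a (lepm_refl a)) -> := eq_uptoM
    (eq_upto_exp_trunc_top (z a) a0 (ltnSn _))
    (fun b _ => erefl (\prod_(mu <- s) exp_trunc (mdeg a).+1 mu (z mu))@_b).
  have := mcoeffMX (exp_prod (mdeg a).+1 s z) a 0%MM.
  rewrite addm0 mcoeff0_exp_prod // => [mX|mu /mem_rem]; last first.
    exact: bell_support_neq0.
  rewrite mulrDl mul1r mcoeffD -scalerAl mcoeffZ ['X_[_] * _]mulrC mX mulr1.
  by rewrite mulrDr [_ * (z a / _)]mulrC divfK // addrK.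
(* The remaining factors have indices strictly between 0 and [a], where [x] and [y] agree. *)
rewrite !bellE /exp_prod; congr (_ * _@_a).
rewrite !big_seq; apply: eq_bigr => mu.
rewrite /s (rem_filter _ (bell_support_uniq a)) mem_filter mem_bell_support.
by case/and3P => /= mua mu0 mule; rewrite xy // /ltm mua.
Qed.

(** Induction on the degree: once the lower variables agree, [bell_top] isolates the top one. *)
Lemma bell_inj x y : (forall a, bell a x = bell a y) ->
  forall a, a != 0%MM -> x a = y a.
Proof.
move=> bxy a; have [n] := ubnP (mdeg a); elim: n a => // n IH a an a0.
have := @bell_top a x y a0; rewrite bxy => /(_ _)/addrI/oppr_inj; apply.
move=> mu mu0 mua; apply: IH; last by rewrite eq_sym; case/andP: mu0.
by rewrite (leq_trans (ltpm_mdeg mua)).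
Qed.

(* [bell a x - x a] only involves variables of degree less than [mdeg a], so
   the inverse is computed degree by degree. *)
Fixpoint bell_inv_upto n g : 'X_{1..r} -> F :=
  if n is n'.+1 then
    fun a => if mdeg a == n' then g a - bell a (bell_inv_upto n' g)
             else bell_inv_upto n' g a
  else fun=> 0.

Definition bell_inv g a : F := bell_inv_upto (mdeg a).+1 g a.

Lemma bell_inv_upto_ge n g a : (n <= mdeg a)%N -> bell_inv_upto n g a = 0.
Proof.
elim: n => //= n IH na; rewrite IH ?(ltnW na) //.
by rewrite gtn_eqF.
Qed.

Lemma bell_inv_upto_lt n g a : (mdeg a < n)%N ->
  bell_inv_upto n g a = bell_inv g a.
Proof.
elim: n => //= n IH; rewrite ltnS leq_eqVlt => /orP[/eqP an|an].
  by rewrite /bell_inv /= an eqxx.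
by rewrite ltn_eqF // IH.
Qed.

Lemma bell_inv0 g : g 0%MM = 1 -> bell_inv g 0%MM = 0.
Proof. by move=> g0; rewrite /bell_inv /= eqxx g0 bell0 subrr. Qed.

Lemma bell_invK g a : g 0%MM = 1 -> bell a (bell_inv g) = g a.
Proof.
move=> g0; have [->|a0] := eqVneq a 0%MM; first by rewrite bell0 g0.
have invE : bell_inv g a = g a - bell a (bell_inv_upto (mdeg a) g).
  by rewrite {1}/bell_inv /= eqxx.
(* Subtracting the top variable lets [bell_top] replace [bell_inv g] by the stage
   [bell_inv_upto (mdeg a) g], which agrees with it in lower degrees and is 0 at [a]. *)
rewrite -[LHS](subrK (bell_inv g a)).
rewrite (bell_top (y := bell_inv_upto (mdeg a) g) a0) => [|mu _ mua].
  by rewrite bell_inv_upto_ge // invE subr0 addrC subrK.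
by rewrite bell_inv_upto_lt // ltpm_mdeg.
Qed.

End BellTheory.

(** * From moment sequences to additive functions *)

Section MomentSequence.
Variables (R : realType) (G : zmodType) (r : nat) (f : 'X_{1..r} -> G -> R[i]).
Hypotheses (hf : moment_sequence f) (hf0 : exists x : G, f 0%MM x != 0).

Let m := f 0%MM.

Lemma generating_exponential : exponential m.
Proof.
split=> // x y; rewrite /m hf (big_pred1 (BMultinom (ltnSn (mdeg 0%MM)))) /=.
  by rewrite subm0 /mnm_bin big1 ?mul1r // => k _; rewrite mnm0E bin0.
by move=> b; rewrite /= lepm0 bmeqP.
Qed.

(** A zero at [x] would give [m y = m (y - x) * m x = 0] for every [y]. *)
Lemma exponential_neq0 x : m x != 0.
Proof.
have [[y my0] mD] := generating_exponential.
by apply: contraNneq my0 => mx0; rewrite -(subrK x y) mD mx0 mulr0.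
Qed.

Let g x a := f a x / m x.

Let g0 x : g x 0%MM = 1. Proof. by rewrite /g divff // exponential_neq0. Qed.

Lemma bell_inv_momentD a x y :
  bell_inv (g (x + y)) a = bell_inv (g x) a + bell_inv (g y) a.
Proof.
(* Bell values do not determine the variable of index 0, which is therefore treated apart. *)
have [->|a0] := eqVneq a 0%MM; first by rewrite !bell_inv0 // addr0.
apply: (@bell_inj _ _ _ (fun b => bell_inv (g x) b + bell_inv (g y) b)) => // b.
(* By [bellD] and the moment equation, both families have the Bell values [g (x + y)]. *)
rewrite bellD (bell_invK _ (g0 _)) /g hf (proj2 generating_exponential) mulr_suml.
apply: eq_bigr => c _; rewrite !(bell_invK _ (g0 _)) /g invfM; ring.
Qed.

End MomentSequence.

Unset Implicit Arguments.
Unset Printing Implicit Defensive.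

Theorem theorem2 (R : realType) (G : zmodType) (r : nat) (hr : (0 < r)%N)
    (f : 'X_{1..r} -> G -> R[i])
    (hf : moment_sequence f)
    (hf0 : exists x : G, f 0%MM x != 0) :
  exists (m : G -> R[i]) (a : 'X_{1..r} -> {additive G -> R[i]}),
    exponential m /\
    forall (alpha : 'X_{1..r}) (x : G),
      f alpha x = bell alpha (fun mu => a mu x) * m x.
Proof.
pose a mu x := bell_inv (fun b => f b x / f 0%MM x) mu.
(* [zmod_morphism] speaks of differences, so additivity is applied to [x - y] and [y]. *)
have aB mu : zmod_morphism (a mu).
  move=> x y; apply/eqP; rewrite eq_sym subr_eq -bell_inv_momentD //.
  by rewrite subrK.
pose aM mu := GRing.isZmodMorphism.Build G R[i] (a mu) (aB mu).
pose A mu : {additive G -> R[i]} := HB.pack (a mu) (aM mu).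
exists (f 0%MM), A; split; first exact: generating_exponential.
move=> b x; rewrite [bell _ _]bell_invK ?divfK ?divff // exponential_neq0 //.
Qed.
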